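(* Let $X=\{x,y,z\}$ and $U=\{u,v,w\}$ be three-element subsets of $\Sigma^+$ such that $X^*$ and $U^*$ are distinct $3$-maximal submonoids of $\Sigma^*$. Then either $X^*\cap U^*=\{\alpha,\beta\}^*$ for some $\alpha,\beta\in\Sigma^*$, or $X^*\cap U^*=(\alpha\gamma^*\beta)^*=\{\alpha\gamma^i\beta : i\ge 0\}^*$ for some $\alpha,\beta,\gamma\in\Sigma^+$.
   Context: $\Sigma$ is a countable alphabet, $\Sigma^*$ the free monoid of finite words over $\Sigma$, $\Sigma^+=\Sigma^*\setminus\{\epsilon\}$, and $Y^*$ denotes the submonoid generated by $Y\subseteq\Sigma^*$. The basis of a submonoid $M$ is $(M\setminus\{\epsilon\})\setminus(M\setminus\{\epsilon\})^2$ and the rank of $M$ is the cardinality of its basis. A submonoid $M$ of rank at most $k$ is $k$-maximal if for every submonoid $M'$ of $\Sigma^*$ of rank at most $k$, $M\subseteq M'$ implies $M=M'$. *)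

(* Defs.v *)
From mathcomp Require Import all_boot.
Set Implicit Arguments. Unset Strict Implicit. Unset Printing Implicit Defensive.

Definition word (Sigma : countType) := seq Sigma.
Definition lang (Sigma : countType) := word Sigma -> Prop.

Inductive gen (Sigma : countType) (Y : lang Sigma) : lang Sigma :=
| gen_nil : gen Y [::]
| gen_cons : forall y w, Y y -> gen Y w -> gen Y (y ++ w).

Definition submonoid (Sigma : countType) (M : lang Sigma) : Prop :=
  M [::] /\ forall u v, M u -> M v -> M (u ++ v).

Definition basis (Sigma : countType) (M : lang Sigma) : lang Sigma :=
  fun w => w <> [::] /\ M w /\
    ~ (exists u v, u <> [::] /\ v <> [::] /\ M u /\ M v /\ w = u ++ v).

Definition rank_le (Sigma : countType) (M : lang Sigma) (k : nat) : Prop :=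
  exists s : seq (word Sigma), uniq s /\ size s <= k /\
    forall w, basis M w <-> w \in s.

Definition lang_eq (Sigma : countType) (A B : lang Sigma) : Prop :=
  forall w, A w <-> B w.

Definition k_maximal (Sigma : countType) (k : nat) (M : lang Sigma) : Prop :=
  submonoid M /\ rank_le M k /\
  forall M' : lang Sigma, submonoid M' -> rank_le M' k ->
    (forall w, M w -> M' w) -> lang_eq M M'.

Definition set3 (Sigma : countType) (a b c : word Sigma) : lang Sigma :=
  fun w => w = a \/ w = b \/ w = c.

Definition set2 (Sigma : countType) (a b : word Sigma) : lang Sigma :=
  fun w => w = a \/ w = b.

Definition langI (Sigma : countType) (A B : lang Sigma) : lang Sigma :=
  fun w => A w /\ B w.

Definition agb (Sigma : countType) (a g b : word Sigma) : lang Sigma :=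
  fun w => exists i : nat, w = a ++ flatten (nseq i g) ++ b.

(* Main.v *)
(** Maximality makes [X] and [U] prefix codes and forbids X* and U* from lying in a common
3-generated monoid. Regrouping letters until every letter starts some word of [X ∪ U], one
lifts the problem along an injective morphism; by maximality at least four letters still occur,
and hence at least four distinct initials. If the intersection Z is nontrivial, X and U share
an initial, so one of them, say U, has three distinct initials, and the other at least two.

Three distinct initials make U* closed under longest common prefixes. If X has three
distinct initials too, then Z is closed as well, and an irreducible element of Z is determined by one of
the at most two common initials. Otherwise let p be the longest common prefix of the two words
of X with the same initial. Two distinct irreducible elements of Z can only diverge at an
element of L = X*p ∩ U*, and how elements of Z continue after q ∈ L does not depend on q.
With α the shortest such q and αγ the next one (if any), exactly one of the two branches
leads back to L, and the irreducible elements form αγ*β. *)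
Require Import Defs.
From mathcomp Require Import all_boot.
From mathcomp Require Import zify.
From Stdlib Require Import Classical.
Set Implicit Arguments. Unset Strict Implicit. Unset Printing Implicit Defensive.

(** * Generated monoids and common prefixes *)

Lemma gen_in (T : countType) (Y : lang T) w : Y w -> gen Y w.
Proof. by move=> Yw; rewrite -[w]cats0; apply: gen_cons => //; apply: gen_nil. Qed.

Lemma gen_cat (T : countType) (Y : lang T) a b : gen Y a -> gen Y b -> gen Y (a ++ b).
Proof.
by move=> Ya Yb; elim: Ya => // y w Yy _ IH; rewrite -catA; apply: gen_cons.
Qed.

Lemma gen_sub (T : countType) (Y Y' : lang T) :
  (forall w, Y w -> gen Y' w) -> forall w, gen Y w -> gen Y' w.
Proof.
by move=> sYY' w; elim=> [|y s /sYY' Yy _ IH]; [apply: gen_nil | apply: gen_cat].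
Qed.

Lemma gen_submonoid (T : countType) (Y : lang T) : submonoid (gen Y).
Proof. by split; [apply: gen_nil | move=> *; apply: gen_cat]. Qed.

Lemma exists_shortest (T : countType) (P : lang T) :
  (exists w, P w) -> exists2 w, P w & forall w', P w' -> size w <= size w'.
Proof.
case=> w; have [n] := ubnP (size w); elim: n w => // n IH w lewn Pw.
case: (classic (exists2 w', P w' & size w' < size w)) => [[w' Pw' lt]|no].
  by apply: (IH w') => //; lia.
exists w => // w' Pw'; rewrite leqNgt; apply/negP => lt; apply: no; by exists w'.
Qed.

Lemma prefix_comparable (T : eqType) (a b c d : seq T) :
  a ++ c = b ++ d -> prefix a b \/ prefix b a.
Proof.
elim: a b => [|x a IH] [|y b] /=; auto.
by case=> -> /IH; rewrite !eqxx.
Qed.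

Lemma prefix_size_eq (T : eqType) (a b : seq T) :
  prefix a b -> size b <= size a -> a = b.
Proof.
by move=> /prefixP[[|c r] ->]; rewrite ?cats0 // size_cat /=; lia.
Qed.

Lemma prefix_of_size (T : eqType) (a b w : seq T) :
  prefix a w -> prefix b w -> size a <= size b -> prefix a b.
Proof.
move=> /prefixP[c ->] /prefixP[d e] le.
case: (prefix_comparable e) => // ba.
by rewrite (prefix_size_eq ba le) prefix_refl.
Qed.

Fixpoint lcp (T : eqType) (a b : seq T) : seq T :=
  match a, b with
  | x :: a', y :: b' => if x == y then x :: lcp a' b' else [::]
  | _, _ => [::]
  end.

Lemma lcp_prefixl (T : eqType) (a b : seq T) : prefix (lcp a b) a.
Proof.
by elim: a b => [|x a IH] [|y b] //=; case: eqP => //= _; rewrite eqxx IH.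
Qed.

Lemma lcp_prefixr (T : eqType) (a b : seq T) : prefix (lcp a b) b.
Proof.
by elim: a b => [|x a IH] [|y b] //=; case: eqP => //= ->; rewrite eqxx IH.
Qed.

Lemma lcp_catl (T : eqType) (h a b : seq T) : lcp (h ++ a) (h ++ b) = h ++ lcp a b.
Proof. by elim: h => //= x h ->; rewrite eqxx. Qed.

Lemma lcp_cat_incomparable (T : eqType) (a b c d : seq T) :
  ~~ prefix a b -> ~~ prefix b a -> lcp (a ++ c) (b ++ d) = lcp a b.
Proof.
elim: a b => [|x a IH] [|y b] //=.
rewrite [y == x]eq_sym; case: eqP => //= _ ab ba; by rewrite IH.
Qed.

Lemma lcp_nil (T : eqType) (a b : seq T) :
  a <> [::] -> ohead a = ohead b -> lcp a b <> [::].
Proof. by case: a b => [|x a] [|y b] //= _ [->]; rewrite eqxx. Qed.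

Lemma lcpC (T : eqType) (a b : seq T) : lcp a b = lcp b a.
Proof.
by elim: a b => [|x a IH] [|y b] //=; rewrite eq_sym; case: eqP => // ->; rewrite IH.
Qed.

Lemma lcp_of_prefix (T : eqType) (a b : seq T) : prefix a b -> lcp a b = a.
Proof.
by case/prefixP=> c ->; rewrite -{1}[a]cats0 lcp_catl cats0.
Qed.

Lemma lcp_ohead (T : eqType) (a b : seq T) : ohead a <> ohead b -> lcp a b = [::].
Proof. by case: a b => [|x a] [|y b] //=; case: eqP => // ->. Qed.

Lemma ohead_catl (T : Type) (a b : seq T) : a <> [::] -> ohead (a ++ b) = ohead a.
Proof. by case: a. Qed.

Definition prefix_code (T : countType) (Y : lang T) : Prop :=
  (forall w, Y w -> w <> [::]) /\
  (forall a b, Y a -> Y b -> prefix a b -> a = b).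

Definition marked (T : countType) (Y : lang T) : Prop :=
  forall a b, Y a -> Y b -> ohead a = ohead b -> a = b.

(** The submonoids generated by prefix codes, described by a closure property that visibly passes to
    intersections. *)
Definition unitary (T : countType) (Z : lang T) : Prop :=
  submonoid Z /\ forall a b, Z a -> Z (a ++ b) -> Z b.

(** For unitary [Z] this is the basis of [Z]: after a proper nonempty prefix in [Z], the rest is in
    [Z] too. *)
Definition irred (T : countType) (Z : lang T) : lang T :=
  fun w => [/\ Z w, w <> [::] & forall p, p <> [::] -> Z p -> prefix p w -> p = w].

Lemma gen_head (T : countType) (Y : lang T) w : gen Y w -> w <> [::] ->
  (forall y, Y y -> y <> [::]) ->
  exists y s, [/\ Y y, gen Y s, w = y ++ s & ohead w = ohead y].
Proof.
case=> // y s Yy Ys _ /(_ y Yy) ny; exists y, s; split=> //.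
by case: y ny {Yy}.
Qed.

(** The first factors of two factorizations of one word are comparable, hence equal, and cancel. *)
Lemma gen_unitary (T : countType) (Y : lang T) : prefix_code Y -> unitary (gen Y).
Proof.
move=> [nY pY]; split; first exact: gen_submonoid.
move=> a b Ya; elim: Ya => // y w Yy _ IH; rewrite -catA => Yb; apply: IH.
have [|y' [s [Yy' Ys e _]]] := gen_head Yb _ nY.
  by case: (y) (nY y Yy).
have eyy' : y = y'.
  by case: (prefix_comparable e) => [/pY-> //|/pY->].
by move: e; rewrite eyy' => /eqP; rewrite eqseq_cat // eqxx /= => /eqP->.
Qed.

Lemma langI_unitary (T : countType) (A B : lang T) :
  unitary A -> unitary B -> unitary (langI A B).
Proof.
move=> [[A0 Ac] Au] [[B0 Bc] Bu]; split; first split=> //.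
  by move=> u v [? ?] [? ?]; split; auto.
by move=> a b [Aa Ba] [Aab Bab]; split; [apply: Au Aab|apply: Bu Bab].
Qed.

(** Equal leading factors are stripped until one factorization ends or the next factors differ. *)
Lemma gen_divergence (T : countType) (Y : lang T) z z' :
  prefix_code Y -> gen Y z -> gen Y z' ->
  [\/ prefix z z', prefix z' z |
    exists h y y' s s', [/\ gen Y h, [/\ Y y, Y y' & y <> y'],
      z = h ++ y ++ s & z' = h ++ y' ++ s']].
Proof.
move=> [nY pY] Yz; elim: Yz z' => [|y w Yy Yw IH] z' Yz'.
  by constructor 1; rewrite prefix0s.
case: Yz' => [|y' w' Yy' Yw']; first by constructor 2; rewrite prefix0s.
case: (eqVneq y y') => [<-|/eqP ne].
  case: (IH _ Yw') => [pre|pre|[h [a [b [s [s' [Yh ab -> ->]]]]]]].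
  - by constructor 1; rewrite prefix_catr ?eqxx.
  - by constructor 2; rewrite prefix_catr ?eqxx.
  - constructor 3; exists (y ++ h), a, b, s, s'; rewrite !catA; split=> //.
    exact: gen_cons.
constructor 3; exists [::], y, y', w, w'; split=> //; exact: gen_nil.
Qed.

(** * Irreducible elements *)

(** A shortest nonempty prefix in [Z] is irreducible, and unitarity keeps the remainder in [Z]. *)
Lemma gen_irred (T : countType) (Z : lang T) : unitary Z -> lang_eq Z (gen (irred Z)).
Proof.
move=> [[Z0 Zc] Zu] w; split; last first.
  by elim=> // y s [Zy _ _] _; apply: Zc.
have [n] := ubnP (size w); elim: n w => // n IH w lewn Zw.
case: (eqVneq w [::]) => [->|/eqP nw]; first exact: gen_nil.
have [|p [np Zp pw] pmin] :=
  @exists_shortest T (fun p => [/\ p <> [::], Z p & prefix p w]).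
  by exists w; rewrite prefix_refl.
have ip : irred Z p.
  split=> // q nq Zq qp; have le := pmin q (And3 nq Zq (prefix_trans qp pw)).
  exact: prefix_size_eq qp le.
case/prefixP: pw lewn Zw => r -> lewn Zw; apply: gen_cons => //.
apply: IH; last exact: Zu Zw.
by move: lewn; rewrite size_cat; case: p np {Zp pmin ip Zw} => //= c p _; lia.
Qed.

Lemma irred_at_most_two (T : countType) (Z : lang T) : unitary Z ->
  (forall a b c, irred Z a -> irred Z b -> irred Z c -> [\/ a = b, a = c | b = c]) ->
  exists alpha beta, lang_eq Z (gen (set2 alpha beta)).
Proof.
move=> uZ atmost; have [[Z0 Zc] _] := uZ.
suff [a [b [Za Zb ab]]] : exists a b, [/\ Z a, Z b & forall w, irred Z w -> set2 a b w].
  exists a, b => w; split.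
    by move/(gen_irred uZ); apply: gen_sub => v /ab ?; apply: gen_in.
  by elim=> // y s [] -> _; apply: Zc.
case: (classic (exists a, irred Z a)) => [[a ia]|no]; last first.
  by exists [::], [::]; split=> // w iw; case: no; exists w.
case: (classic (exists2 b, irred Z b & a <> b)) => [[b ib ab]|no].
  exists a, b; split; [by case: ia|by case: ib|].
  move=> w iw; case: (atmost _ _ _ ia ib iw) => // ->; by [left|right].
exists a, a; split; [by case: ia|by case: ia|].
move=> w iw; left; case: (eqVneq a w) => // /eqP aw; by case: no; exists w.
Qed.

(* [L] stands for the branching points X*p ∩ U*; the hypothesis on [ohead] says that at most two
   letters can follow a branching point. *)
Lemma branching_structure (T : countType) (Z L : lang T) : unitary Z ->
  (forall z z', irred Z z -> irred Z z' -> z <> z' -> L (lcp z z')) ->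
  (forall q q' s, L q -> L q' -> Z (q ++ s) -> Z (q' ++ s)) ->
  (forall q s1 s2 s3, L q -> Z (q ++ s1) -> Z (q ++ s2) -> Z (q ++ s3) ->
     [\/ ohead s1 = ohead s2, ohead s1 = ohead s3 | ohead s2 = ohead s3]) ->
  (forall q, L q -> ~ Z q) ->
  (exists alpha beta, lang_eq Z (gen (set2 alpha beta))) \/
  (exists alpha beta gamma, alpha <> [::] /\ beta <> [::] /\ gamma <> [::] /\
     lang_eq Z (gen (agb alpha gamma beta))).
Proof.
move=> uZ Llcp Lres Lbin LnZ; have [[Z0 Zc] Zu] := uZ.
case: (classic (exists a b, [/\ irred Z a, irred Z b & a <> b])); last first.
  move=> no; left; apply: irred_at_most_two => // a b c ia ib ic.
  case: (eqVneq a b) => [|/eqP ab]; first by constructor 1.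
  by case: no; exists a, b.
case=> [z1 [z2 [iz1 iz2 ne12]]].
(* Only branching points inside some irreducible element can be exchanged without losing
   irreducibility. *)
pose Lp q := L q /\ exists2 z, irred Z z & prefix q z.
have Lplcp z z' : irred Z z -> irred Z z' -> z <> z' -> Lp (lcp z z').
  by move=> iz iz' ne; split; [apply: Llcp | exists z; rewrite ?lcp_prefixl].
have [|al Lal almin] := @exists_shortest T Lp.
  by exists (lcp z1 z2); apply: Lplcp.
have al_prefix z : irred Z z -> exists s, z = al ++ s.
  move=> iz; apply/prefixP; case: (Lal) => _ [z0 iz0 pz0].
  case: (eqVneq z z0) => [-> //|/eqP ne].
  (* Both [al] and [lcp z z0] are prefixes of [z0], and the latter is a branching point, so it is no
     shorter than [al]. *)
  have le := almin _ (Lplcp _ _ iz iz0 ne).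
  exact: prefix_trans (prefix_of_size pz0 (lcp_prefixr z z0) le) (lcp_prefixl z z0).
(* A nonempty prefix of [q' ++ s] in [Z] either lies within [q'], hence within an irreducible [z'],
   forcing [q' = z'], or extends [q'] and carries over to a prefix of [q ++ s]. *)
have transfer q q' s : Lp q -> Lp q' -> irred Z (q ++ s) -> irred Z (q' ++ s).
  move=> [Lq _] [Lq' [z' [Zz' nz' iz'] pz']] [Zqs nqs iqs]; split.
  - exact: Lres Zqs.
  - by case: q' Lq' {pz'} => // /LnZ.
  - move=> p np Zp pq.
    case/prefixP: (pq) => r e; case: (prefix_comparable e) => [q'p|pq']; last first.
      have ez := iz' _ np Zp (prefix_trans pq' pz').
      case: (LnZ _ Lq'); suff -> : q' = z' by [].
      by apply: prefix_size_eq => //; rewrite -ez; apply: size_prefix.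
    case/prefixP: q'p => p1 ep; rewrite ep in pq Zp *; congr (_ ++ _).
    rewrite prefix_catr // eqxx /= in pq.
    have /eqP : q ++ p1 = q ++ s.
      apply: iqs; [|exact: Lres Zp|by rewrite prefix_catr ?eqxx].
      by case: (q) Lq => // /LnZ.
    by rewrite eqseq_cat // eqxx => /eqP.
(* If no branching point properly extends [al], the letter after [al] determines an irreducible
   element, and only two letters are possible. *)
case: (classic (exists g, g <> [::] /\ Lp (al ++ g))); last first.
  move=> no; left; apply: irred_at_most_two => // a b c ia ib ic.
  have [a' ea] := al_prefix _ ia; have [b' eb] := al_prefix _ ib.
  have [c' ec] := al_prefix _ ic; subst a b c.
  have split1 s t : irred Z (al ++ s) -> irred Z (al ++ t) -> ohead s = ohead t -> s = t.
    move=> is_ it oh; case: (eqVneq s t) => // /eqP ne; case: no; exists (lcp s t); split.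
      apply: lcp_nil oh => es; rewrite es cats0 in is_.
      by case: is_ => /(LnZ _ Lal.1).
    by rewrite -lcp_catl; apply: Lplcp => // /eqP; rewrite eqseq_cat // eqxx => /eqP.
  case: (Lbin al a' b' c' Lal.1); [by case: ia|by case: ib|by case: ic|..] => oh;
    [constructor 1|constructor 2|constructor 3]; congr (_ ++ _); exact: split1.
case/exists_shortest => ga [nga Lga] gamin; right.
have [|be ibe bemin] := @exists_shortest T (fun s => irred Z (al ++ s)).
  by have [s e] := al_prefix _ iz1; exists s; rewrite -e.
have nbe s : irred Z (al ++ s) -> s <> [::].
  by move=> is_ e; rewrite e cats0 in is_; case: is_ => /(LnZ _ Lal.1).
have add_ga s : irred Z (al ++ s) -> irred Z (al ++ ga ++ s).
  by rewrite catA; apply: transfer.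
have del s t : Lp (al ++ t) -> irred Z (al ++ t ++ s) -> irred Z (al ++ s).
  by move=> Lt; rewrite catA; apply: transfer.
have sep s t : irred Z (al ++ s) -> irred Z (al ++ t) -> s <> t -> ohead s = ohead t ->
    [/\ lcp s t <> [::], Lp (al ++ lcp s t) & size ga <= size (lcp s t)].
  move=> is_ it ne oh; have nl := lcp_nil (nbe _ is_) oh.
  have Ll : Lp (al ++ lcp s t).
    by rewrite -lcp_catl; apply: Lplcp => // /eqP; rewrite eqseq_cat // eqxx => /eqP.
  by split=> //; apply: gamin.
(* A continuation sharing its first letter with [ga ++ be] agrees with it up to a branching point,
   hence at least along [ga]. *)
have head_ga s : irred Z (al ++ s) -> ~~ prefix ga s -> ohead s <> ohead (ga ++ be).
  move=> is_ pre oh.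
  case: (eqVneq s (ga ++ be)) => [e|/eqP ne]; first by rewrite e prefix_prefix in pre.
  have [_ _ le] := sep _ _ is_ (add_ga _ ibe) ne oh.
  have := prefix_of_size (prefix_prefix ga be) (lcp_prefixr s _) le.
  by move/prefix_trans => /(_ _ (lcp_prefixl _ _)); apply/negP.
have be_ga : ~~ prefix ga be.
  apply/negP => /prefixP[r e]; rewrite e in ibe.
  have := bemin _ (del _ _ Lga ibe); rewrite e size_cat.
  by case: (ga) nga => //= *; lia.
(* Two of the first letters of [s], [be] and [ga ++ be] coincide. By [head_ga] these belong to [s]
   and [be]; cutting their common prefix off [be] would then give a shorter continuation. *)
have base s : irred Z (al ++ s) -> ~~ prefix ga s -> s = be.
  move=> is_ pre; case: (eqVneq s be) => // /eqP ne.
  case: (Lbin al s be (ga ++ be) Lal.1).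
  - by case: is_.
  - by case: ibe.
  - by case: (add_ga _ ibe).
  - move=> oh; have [nl Ll _] := sep _ _ is_ ibe ne oh.
    case/prefixP: (lcp_prefixr s be) => r e; rewrite e in ibe.
    have := bemin _ (del _ _ Ll ibe); rewrite {1}e size_cat.
    by case: (lcp s be) nl => //= *; lia.
  - by move/(head_ga _ is_ pre).
  - by move/(head_ga _ ibe be_ga).
have irredE w : irred Z w <-> agb al ga be w.
  split=> [iw|[i ->]]; last first.
    by elim: i => //= i IH; rewrite -catA; apply: add_ga.
  have [s e] := al_prefix _ iw; subst w.
  (* Descent on length: each leading [ga] is removed until [base] applies. *)
  have [n] := ubnP (size s); elim: n s iw => // n IH s is_ lesn.
  case: (boolP (prefix ga s)) => [/prefixP[r e]|pre]; last first.
    by exists 0; rewrite (base _ is_ pre).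
  subst s; case: (IH r).
  - exact: del is_.
  - by move: lesn; rewrite size_cat; case: (ga) nga => //= *; lia.
  - move=> i /eqP; rewrite eqseq_cat // eqxx => /eqP ->.
    by exists i.+1; rewrite /= -catA.
exists al, be, ga; split; [|split; [exact: nbe|split=> //]].
  by move=> e; rewrite e in Lal; case: (LnZ _ Lal.1).
by move=> w; rewrite (gen_irred uZ w); split; apply: gen_sub => v /irredE; apply: gen_in.
Qed.

(** * Intersections with a code whose words have distinct initials *)

Lemma gen_lcp_marked (T : countType) (Y : lang T) z z' :
  prefix_code Y -> marked Y -> gen Y z -> gen Y z' -> gen Y (lcp z z').
Proof.
move=> pcY mY Yz Yz'; have [nY _] := pcY.
case: (gen_divergence pcY Yz Yz') => [pre|pre|].
- by rewrite lcp_of_prefix.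
- by rewrite lcpC lcp_of_prefix.
case=> h [y [y' [s [s' [Yh [Yy Yy' ne] -> ->]]]]].
rewrite lcp_catl lcp_ohead ?cats0 // !ohead_catl; try exact: nY.
by move/(mY _ _ Yy Yy').
Qed.

Lemma irred_prefix (T : countType) (Z : lang T) z z' :
  irred Z z -> irred Z z' -> prefix z z' -> z = z'.
Proof. by move=> [Zz nz _] [_ _ h]; apply: h. Qed.

(** The longest common prefix of two irreducible elements with the same initial is a nonempty
    element of the intersection, hence equal to both. *)
Lemma marked_intersection (T : countType) (X U : lang T) (C : seq (option T)) :
  prefix_code X -> prefix_code U -> marked X -> marked U -> size C <= 2 ->
  (forall z, langI (gen X) (gen U) z -> z <> [::] -> ohead z \in C) ->
  exists alpha beta, lang_eq (langI (gen X) (gen U)) (gen (set2 alpha beta)).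
Proof.
move=> pcX pcU mX mU leC hC.
have same a b : irred (langI (gen X) (gen U)) a -> irred (langI (gen X) (gen U)) b ->
    ohead a = ohead b -> a = b.
  move=> [[Xa Ua] na ia] [[Xb Ub] nb ib] /(lcp_nil na) nl.
  have Zl : langI (gen X) (gen U) (lcp a b) by split; apply: gen_lcp_marked.
  by rewrite -(ia _ nl Zl (lcp_prefixl a b)) {1}(ib _ nl Zl (lcp_prefixr a b)).
apply: irred_at_most_two; first by apply: langI_unitary; apply: gen_unitary.
move=> a b c ia ib ic.
have [[Za na _] [Zb nb _] [Zc nc _]] := And3 ia ib ic.
have := (hC _ Za na, hC _ Zb nb, hC _ Zc nc).
case: C leC {hC} => [|p [|q []]] //= _ [[]]; rewrite ?in_nil ?inE //.
  by move=> /eqP ea /eqP eb _; constructor 1; apply: same; rewrite // ea.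
case/orP=> /eqP ea /orP[] /eqP eb /orP[] /eqP ec;
  first [ by constructor 1; apply: same; rewrite // ea eb
        | by constructor 2; apply: same; rewrite // ea ec
        | by constructor 3; apply: same; rewrite // eb ec ].
Qed.

(** The pair [x1], [x2] is the only ambiguity when reading a word of [X] from its initial, and the
    letter after their common prefix [p] resolves it. *)
Lemma half_marked_intersection (T : countType) (X U : lang T) (x1 x2 : seq T) :
  prefix_code X -> prefix_code U -> marked U ->
  X x1 -> X x2 -> x1 <> x2 -> ohead x1 = ohead x2 ->
  (forall x x', X x -> X x' -> ohead x = ohead x' ->
     [\/ x = x', x = x1 /\ x' = x2 | x = x2 /\ x' = x1]) ->
  (forall z z', langI (gen X) (gen U) z -> langI (gen X) (gen U) z' ->
     z <> [::] -> z' <> [::] -> ohead z = ohead z') ->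
  (exists alpha beta, lang_eq (langI (gen X) (gen U)) (gen (set2 alpha beta))) \/
  (exists alpha beta gamma, alpha <> [::] /\ beta <> [::] /\ gamma <> [::] /\
     lang_eq (langI (gen X) (gen U)) (gen (agb alpha gamma beta))).
Proof.
move=> pcX pcU mU Xx1 Xx2 ne12 oh12 pair sameZ; have [nX pX] := pcX.
have [[_ uX] [_ uU]] := conj (gen_unitary pcX) (gen_unitary pcU).
pose p := lcp x1 x2.
have np : p <> [::] by apply: lcp_nil => //; apply: nX.
have [n12 n21] : ~~ prefix x1 x2 /\ ~~ prefix x2 x1.
  by split; apply/negP => /pX h; apply: ne12; rewrite h.
have ohp : ohead p = ohead x1.
  by have /prefixP[s e] := lcp_prefixl x1 x2; rewrite [in RHS]e ohead_catl.
(* Neither of [x1], [x2] is a prefix of the other, so both properly extend [p]. *)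
have after_p x s t : X x -> ohead x = ohead p -> p ++ s = x ++ t ->
    exists c r, [/\ x = p ++ c :: r & ohead s = Some c].
  move=> Xx; rewrite ohp => ohx.
  have : x = x1 \/ x = x2 by case: (pair _ _ Xx Xx1 ohx) => [|[]|[]]; auto.
  case=> ->.
    have /prefixP[[|c r] e] := lcp_prefixl x1 x2.
      by case/negP: n12; rewrite e cats0 lcp_prefixr.
    rewrite {1}e -/p -catA => /eqP; rewrite eqseq_cat // eqxx => /eqP ->.
    by exists c, r.
  have /prefixP[[|c r] e] := lcp_prefixr x1 x2.
    by case/negP: n21; rewrite e cats0 lcp_prefixl.
  rewrite {1}e -/p -catA => /eqP; rewrite eqseq_cat // eqxx => /eqP ->.
  by exists c, r.
apply: (@branching_structure _ _
  (fun q => gen U q /\ exists2 h, gen X h & q = h ++ p)).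
- by apply: langI_unitary; apply: gen_unitary.
- move=> z z' iz iz' ne; have [[[Xz Uz] nz mz] [[Xz' Uz'] nz' mz']] := conj iz iz'.
  have Ul : gen U (lcp z z') by apply: gen_lcp_marked.
  split=> //; case: (gen_divergence pcX Xz Xz') => [/(irred_prefix iz iz') //|
    /(irred_prefix iz' iz) /esym //|].
  case=> h [y [y' [s [s' [Xh [Xy Xy' ney] ez ez']]]]].
  (* If the next factors have different initials, the common prefix is [h] itself and lies in both
     monoids; it is nonempty by [sameZ], against irreducibility. *)
  case: (eqVneq (ohead y) (ohead y')) => [oh|/eqP oh]; last first.
    have el : lcp z z' = h.
      by rewrite ez ez' lcp_catl lcp_ohead ?cats0 // !ohead_catl //; apply: nX.
    have nl : lcp z z' <> [::] by apply: lcp_nil => //; apply: sameZ.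
    have Zl : langI (gen X) (gen U) (lcp z z') by rewrite {1}el in Ul *; split; rewrite ?el.
    by case: ne; rewrite -(mz _ nl Zl (lcp_prefixl _ _)) {1}(mz' _ nl Zl (lcp_prefixr _ _)).
  exists h => //; rewrite ez ez' lcp_catl; congr (_ ++ _).
  case: (pair _ _ Xy Xy' oh) => [//|[-> ->]|[-> ->]]; first exact: lcp_cat_incomparable.
  by rewrite lcp_cat_incomparable // lcpC.
- move=> q q' s [Uq [h Xh eq_]] [Uq' [h' Xh' eq']] [Xs Us]; split.
    rewrite eq' -catA; apply: gen_cat => //; apply: uX Xh _.
    by rewrite catA -eq_.
  by apply: gen_cat => //; apply: uU Us.
- move=> q s1 s2 s3 [Uq [h Xh ->]] [X1 _] [X2 _] [X3 _].
  have next s : gen X ((h ++ p) ++ s) -> exists y c r,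
      [/\ y = p ++ c :: r, ohead s = Some c & y = x1 \/ y = x2].
    rewrite -catA => /(uX _ _ Xh) Xps.
    have [|y [t [Xy _ e]]] := gen_head Xps _ nX; first by case: (p) np.
    rewrite ohead_catl // => oh.
    have [c [r [ey es]]] := after_p _ _ _ Xy (esym oh) e.
    exists y, c, r; split=> //; rewrite ohp in oh.
    by case: (pair _ _ Xy Xx1 (esym oh)) => [|[]|[]]; auto.
  have [y1 [c1 [r1 [e1 -> h1]]]] := next _ X1.
  have [y2 [c2 [r2 [e2 -> h2]]]] := next _ X2.
  have [y3 [c3 [r3 [e3 -> h3]]]] := next _ X3.
  have eqc y c r y' c' r' : y = p ++ c :: r -> y' = p ++ c' :: r' -> y = y' -> Some c = Some c'.
    by move=> -> -> /eqP; rewrite eqseq_cat // eqxx /= => /eqP[->].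
  have : [\/ y1 = y2, y1 = y3 | y2 = y3].
    case: h1 h2 h3 => -> [] -> [] ->; first
      [by constructor 1|by constructor 2|by constructor 3].
  case=> e; [constructor 1|constructor 2|constructor 3];
    [exact: eqc e1 e2 e|exact: eqc e1 e3 e|exact: eqc e2 e3 e].
(* Otherwise [p] would lie in X*, and its first factor would be a prefix of both [x1] and [x2],
   hence equal to both. *)
- move=> q [_ [h Xh ->]] [Xq _]; have Xp := uX _ _ Xh Xq.
  have [y [t [Xy _ e _]]] := gen_head Xp np nX.
  have yp : prefix y p by rewrite e prefix_prefix.
  have ey1 := pX _ _ Xy Xx1 (prefix_trans yp (lcp_prefixl _ _)).
  have ey2 := pX _ _ Xy Xx2 (prefix_trans yp (lcp_prefixr _ _)).
  by case: ne12; rewrite -ey1.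
Qed.

(** * Counting initials *)

Lemma uniq_heads_marked (T : countType) (X : seq (seq T)) :
  uniq (map ohead X) -> marked (fun w => w \in X).
Proof.
elim: X => [|x X IH] //= /andP[nx uX] a b; rewrite !inE.
case: eqP => [->|_] /= Xa; case: eqP => [->|_] //= Xb oh.
- by case/negP: nx; rewrite oh map_f.
- by case/negP: nx; rewrite -oh map_f.
- exact: IH.
Qed.

Lemma two_heads_pair (T : countType) (X : seq (seq T)) :
  uniq X -> size X = 3 -> size (undup (map ohead X)) = 2 ->
  exists x1 x2, [/\ x1 \in X, x2 \in X, x1 <> x2, ohead x1 = ohead x2 &
    forall x x', x \in X -> x' \in X -> ohead x = ohead x' ->
     [\/ x = x', x = x1 /\ x' = x2 | x = x2 /\ x' = x1]].
Proof.
case: X => [|a [|b [|c []]]] //=; rewrite !inE negb_or andbT.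
move=> /andP[/andP[/eqP ab /eqP ac] /eqP bc] _.
case: (eqVneq (ohead a) (ohead b)) => [eab|/eqP nab] /=.
  case: (eqVneq (ohead b) (ohead c)) => [ebc|/eqP nbc] //= _.
  exists a, b; split; rewrite ?inE ?eqxx ?orbT // => x x'.
  rewrite !inE => /or3P[] /eqP-> /or3P[] /eqP-> oh; try congruence;
    first [by constructor 1|by constructor 2|by constructor 3].
case: (eqVneq (ohead a) (ohead c)) => [eac|/eqP nac] /=.
  case: (eqVneq (ohead b) (ohead c)) => [ebc|/eqP nbc] //= _.
  exists a, c; split; rewrite ?inE ?eqxx ?orbT // => x x'.
  rewrite !inE => /or3P[] /eqP-> /or3P[] /eqP-> oh; try congruence;
    first [by constructor 1|by constructor 2|by constructor 3].
case: (eqVneq (ohead b) (ohead c)) => [ebc|/eqP nbc] //= _.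
exists b, c; split; rewrite ?inE ?eqxx ?orbT // => x x'.
rewrite !inE => /or3P[] /eqP-> /or3P[] /eqP-> oh; try congruence;
  first [by constructor 1|by constructor 2|by constructor 3].
Qed.

Lemma langIC (T : countType) (A B : lang T) : lang_eq (langI A B) (langI B A).
Proof. by move=> w; split=> -[]. Qed.

(** At least four initials in all, at most three per code and at least one in common leave three
    distributions, each covered by one of the two intersection lemmas. *)
Lemma four_heads_intersection (T : countType) (X U : seq (seq T)) :
  uniq X -> uniq U -> size X = 3 -> size U = 3 ->
  prefix_code (fun w => w \in X) -> prefix_code (fun w => w \in U) ->
  4 <= size (undup (map ohead (X ++ U))) ->
  let Z := langI (gen (fun w => w \in X)) (gen (fun w => w \in U)) in
  (exists alpha beta, lang_eq Z (gen (set2 alpha beta))) \/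
  (exists alpha beta gamma, alpha <> [::] /\ beta <> [::] /\ gamma <> [::] /\
     lang_eq Z (gen (agb alpha gamma beta))).
Proof.
move=> uX uU sX sU pcX pcU four Z.
have uZ : unitary Z by apply: langI_unitary; apply: gen_unitary.
case: (classic (exists a, irred Z a)) => [[a [Za na _]]|no]; last first.
  by left; apply: irred_at_most_two => // a b c ia; case: no; exists a.
pose C := [seq o <- undup (map ohead X) | o \in map ohead U].
have hC z : Z z -> z <> [::] -> ohead z \in C.
  move=> [Xz Uz] nz.
  have [y [s [Xy _ _ e]]] := gen_head Xz nz pcX.1.
  have [y' [s' [Uy' _ _ e']]] := gen_head Uz nz pcU.1.
  by rewrite mem_filter mem_undup {1}e' e !map_f.
have posC : 0 < size C by have := hC _ Za na; case: (C).
(* Inclusion-exclusion for the two sets of initials. *)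
have sizes : size (undup (map ohead (X ++ U))) + size C =
    size (undup (map ohead X)) + size (undup (map ohead U)).
  rewrite map_cat undup_cat size_cat !size_filter.
  by rewrite -(count_predC [in map ohead U] (undup (map ohead X))) addnAC [X in X + _]addnC.
have := size_undup (map ohead X); have := size_undup (map ohead U).
rewrite !size_map sX sU => leU leX.
have sameZ z z' : size C = 1 -> Z z -> Z z' -> z <> [::] -> z' <> [::] -> ohead z = ohead z'.
  move=> sC Zz Zz' nz nz'; have := (hC _ Zz nz, hC _ Zz' nz').
  by case: (C) sC => [|o []] //= _ []; rewrite !inE => /eqP-> /eqP->.
have mk Y : size Y = 3 -> size (undup (map ohead Y)) = 3 -> marked (fun w => w \in Y).
  move=> sY suY; apply: uniq_heads_marked; apply/negPn.
  by rewrite -ltn_size_undup suY size_map sY.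
have [[X3 U3 C2]|[X2 U3 C1]|[X3 U2 C1]] : [\/
    [/\ size (undup (map ohead X)) = 3, size (undup (map ohead U)) = 3 & size C <= 2],
    [/\ size (undup (map ohead X)) = 2, size (undup (map ohead U)) = 3 & size C = 1] |
    [/\ size (undup (map ohead X)) = 3, size (undup (map ohead U)) = 2 & size C = 1]].
  move: four sizes leU leX posC; set nXU := size (undup (map ohead (X ++ U))).
  set nX := size (undup (map ohead X)); set nU := size (undup (map ohead U)).
  set c := size C => four sizes leU leX posC.
  have : nX = 3 /\ nU = 3 /\ c <= 2 \/ nX = 2 /\ nU = 3 /\ c = 1 \/
    nX = 3 /\ nU = 2 /\ c = 1 by lia.
  by case=> [[? []]|[[? []]|[? []]]]; [constructor 1|constructor 2|constructor 3].
- by left; apply: (@marked_intersection _ _ _ C) => //; apply: mk.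
- have [x1 [x2 [Xx1 Xx2 ne oh pair]]] := two_heads_pair uX sX X2.
  apply: (@half_marked_intersection _ _ _ x1 x2) => //; first exact: mk.
  by move=> z z'; apply: sameZ.
- have [x1 [x2 [Xx1 Xx2 ne oh pair]]] := two_heads_pair uU sU U2.
  have := @half_marked_intersection _ (fun w => w \in U) (fun w => w \in X) x1 x2
    pcU pcX (mk _ _ sX X3) Xx1 Xx2 ne oh pair.
  case=> [z z' /langIC Zz /langIC Zz'|[al [be e]]|[al [be [ga [nal [nbe [nga e]]]]]]].
  + exact: sameZ.
  + by left; exists al, be => w; rewrite -e; apply: langIC.
  + by right; exists al, be, ga; do 3!split=> //; move=> w; rewrite -e; apply: langIC.
Qed.

(** * Reduction to letters that occur as initials *)

Definition subst (T S : Type) (f : T -> seq S) (w : seq T) : seq S := flatten (map f w).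

Lemma subst_cat (T S : Type) (f : T -> seq S) a b :
  subst f (a ++ b) = subst f a ++ subst f b.
Proof. by rewrite /subst map_cat flatten_cat. Qed.

Lemma subst_comp (T S R : Type) (f : T -> seq S) (g : S -> seq R) w :
  subst (fun t => subst g (f t)) w = subst g (subst f w).
Proof. by elim: w => //= t w IH; rewrite /= subst_cat -IH. Qed.

Lemma gen_subst (T S : countType) (f : T -> seq S) (Y : lang T) w :
  gen (fun v => exists2 y, Y y & v = subst f y) w <-> exists2 v, gen Y v & w = subst f v.
Proof.
split=> [|[v Yv ->]].
  elim=> [|y v [y' Yy' ->] _ [v' Yv' ->]]; first by exists [::] => //; apply: gen_nil.
  by exists (y' ++ v'); rewrite ?subst_cat //; apply: gen_cons.
elim: Yv => [|y v' Yy _ IH]; first exact: gen_nil.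
by rewrite subst_cat; apply: gen_cons => //; exists y.
Qed.

(** A pair [(t, n)] is a new letter standing for [t] followed by [n] copies of [d]. *)
Definition blockT (T : countType) (d : T) : countType := ({t : T | t != d} * nat)%type.

Definition block (T : countType) (d : T) (b : blockT d) : seq T := val b.1 :: nseq b.2 d.

(* Groups each letter with the run of [d]'s that follows it; the first component counts
   the [d]'s in front of the first other letter. *)
Definition block_enc (T : countType) (d : T) (w : seq T) : nat * seq (blockT d) :=
  foldr (fun t (r : nat * seq (blockT d)) =>
    if insub t is Some t' then (0, (t', r.1) :: r.2) else (r.1.+1, r.2)) (0, [::]) w.

Lemma block_encK (T : countType) (d : T) w :
  nseq (block_enc d w).1 d ++ subst (@block T d) (block_enc d w).2 = w.
Proof.
elim: w => //= t w IH; case: insubP => [t' _ et'|/negPn/eqP ->] /=.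
  by rewrite /subst /= /block /= et' IH.
by rewrite IH.
Qed.

Lemma size_block_enc (T : countType) (d : T) w :
  size (block_enc d w).2 = count (predC1 d) w.
Proof. by elim: w => //= t w IH; case: insubP => [t' -> _|/negPf->] /=; rewrite IH. Qed.

Lemma block_enc_head (T : countType) (d : T) w :
  ohead w <> Some d -> (block_enc d w).1 = 0.
Proof. by case: w => //= t w; case: insubP => //= /negPn/eqP-> []. Qed.

(** No block begins with [d], so every run of [d] is delimited and its length can be read back. *)
Lemma block_inj (T : countType) (d : T) : injective (subst (@block T d)).
Proof.
have nd (w : seq (blockT d)) k s : subst (@block T d) w = nseq k.+1 d ++ s -> False.
  by case: w => [|[[t ntd] n] w] //= [e _]; case/eqP: ntd.
have run k k' (w w' : seq (blockT d)) : nseq k d ++ subst (@block T d) w =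
    nseq k' d ++ subst (@block T d) w' -> k = k' /\ subst (@block T d) w = subst (@block T d) w'.
  elim: k k' => [|k IH] [|k'] //=; first by move/(@nd _ k').
    by move/esym/(@nd _ k).
  by case=> /IH[-> ->].
elim=> [|[t n] w IH] [|[t' n'] w'] //= [et].
rewrite -!/(subst _ _) => /run[-> /IH->]; congr ((_, _) :: _).
exact: val_inj.
Qed.

(** A letter [d] that occurs but is never an initial is absorbed into the letters before it; this
    shortens the total length, so the process stops. *)
Lemma reduce_to_heads (T : countType) (S : seq (seq T)) :
  (forall s, s \in S -> s <> [::]) ->
  exists (T' : countType) (f : T' -> seq T) (S' : seq (seq T')),
    [/\ injective (subst f), S = map (subst f) S' &
        forall s t, s \in S' -> t \in s -> Some t \in map ohead S'].
Proof.
have [n] := ubnP (size (flatten S)); elim: n T S => // n IH T S leS nS.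
case: (classic (exists s d, [/\ s \in S, d \in s & Some d \notin map ohead S]));
    last first.
  move=> no; exists T, (fun t => [:: t]), S.
  have sid w : subst (fun t : T => [:: t]) w = w by elim: w => //= t w IHw; rewrite -{2}IHw.
  split; [by move=> a b; rewrite !sid|by rewrite (eq_map sid) map_id|].
  by move=> s t Ss st; apply/negPn/negP => nt; apply: no; exists s, t.
case=> s [d [Ss sd nd]].
(* No word of [S] starts with [d], so there is no leading run to lose. *)
have encK w : w \in S -> subst (@block T d) (block_enc d w).2 = w.
  move=> Sw; rewrite -{2}(block_encK d w) block_enc_head // => e.
  by case/negP: nd; rewrite -e map_f.
have [||T' [f [S' [injf eS hS]]]] := IH _ (map (fun w => (block_enc d w).2) S).
- rewrite -ltnS; apply: leq_trans leS; rewrite ltnS !size_flatten /shape -map_comp.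
  rewrite (eq_map (size_block_enc d)).
  have le R : sumn (map (count (predC1 d)) R) <= sumn (map size R).
    by elim: R => //= w R le; rewrite leq_add ?count_size.
  case/splitPr: Ss {IH nS nd encK} => S1 S2; rewrite !map_cat !sumn_cat /=.
  have lt : count (predC1 d) s < size s.
    by rewrite -(count_predC (predC1 d) s) -{1}[count _ s]addn0 ltn_add2l -has_count;
       apply/hasP; exists d; rewrite //= eqxx.
  by rewrite -addnS -addSn; apply: leq_add (le S1) (leq_add lt (le S2)).
- move=> w /mapP[v Sv ->] e; apply: (nS _ Sv).
  by rewrite -(encK _ Sv) e.
exists T', (fun t => subst (@block T d) (f t)), S'; split=> //.
  by move=> a b; rewrite !subst_comp => /block_inj/injf.
rewrite (eq_map (subst_comp _ _)) map_comp -eS -map_comp -[LHS]map_id.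
by apply/eq_in_map => w Sw /=; rewrite encK.
Qed.

(** * Consequences of maximality *)

Lemma basis_gen (T : countType) (Y : lang T) w : basis (gen Y) w -> Y w.
Proof.
move=> [nw [Yw irr]]; elim: Yw nw irr => // y s Yy Ys IH _ irr.
case: (eqVneq s [::]) => [->|/eqP ns]; first by rewrite cats0.
case: (eqVneq y [::]) => [ey|/eqP ny]; first by move: irr; rewrite ey /= => /(IH ns).
by case: irr; exists y, s; split=> //; split=> //; split; first exact: gen_in.
Qed.

(** The basis is contained in [D]; as it is not a boolean predicate, its list is sifted out of [D]
    classically. *)
Lemma rank_le_gen (T : countType) (D : seq (seq T)) k :
  size D <= k -> rank_le (gen (fun w => w \in D)) k.
Proof.
move=> leD.
have [s [us ss sP]] : exists s, [/\ uniq s, size s <= size D &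
    forall w, w \in s <-> w \in D /\ basis (gen (fun w => w \in D)) w].
  move: (basis _) => P.
  elim: (D) => [|d D' [s [us ss sP]]]; first by exists [::]; split=> // w; split=> // -[].
  case: (classic (P d /\ d \notin D')) => [[Pd dD']|no].
    exists (d :: s); split=> //=.
      by rewrite us andbT; apply/negP => /sP[dD _]; case/negP: dD'.
    move=> w; rewrite !inE; split.
      by case/orP=> [/eqP->|/sP[-> Pw]]; rewrite ?eqxx ?orbT.
    by case=> /orP[-> //|Dw] Pw; apply/orP; right; apply/sP.
  exists s; split=> //=; first exact: leqW.
  move=> w; rewrite inE; split=> [/sP[-> Pw]|[/orP[/eqP->|Dw] Pw]]; rewrite ?orbT //.
    by apply/sP; split=> //; apply/negPn/negP => nd; apply: no; split.
  by apply/sP.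
exists s; split=> //; split; first exact: leq_trans ss leD.
by move=> w; rewrite sP; split=> [Bw|[]//]; split=> //; apply: basis_gen Bw.
Qed.

Lemma k_maximal_gen (T : countType) k (M : lang T) (D : seq (seq T)) :
  k_maximal k M -> size D <= k -> (forall w, M w -> gen (fun w => w \in D) w) ->
  lang_eq M (gen (fun w => w \in D)).
Proof.
move=> [_ [_ max]] leD; apply: max; [exact: gen_submonoid | exact: rank_le_gen].
Qed.

(** Otherwise there is room for one more generator, and maximality puts every word into [M]; then
    [N] is contained in [M], hence equal to it. *)
Lemma k_maximal_not_smaller (T : countType) k (M N : lang T) (D : seq (seq T)) :
  k_maximal k M -> k_maximal k N -> ~ lang_eq M N -> size D < k ->
  ~ (forall w, M w -> gen (fun w => w \in D) w).
Proof.
move=> kM kN ne lt MD; apply: ne.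
have full w : M w.
  have := @k_maximal_gen _ _ _ (w :: D) kM lt.
  move=> h; apply/h; last by apply: gen_in; rewrite inE eqxx.
  by move=> v /MD; apply: gen_sub => y Dy; apply: gen_in; rewrite inE Dy orbT.
have [_ [_ max]] := kN; have [sM [rM _]] := kM.
by move=> w; split=> Aw //; apply/(max M sM rM).
Qed.

(** If [b = a ++ s], replacing [b] by [s] loses nothing, so maximality puts [s] into [M]. Being
    shorter than [b], [s] is a product of the other generators, and so is [b], contradicting
    [k_maximal_not_smaller]. *)
Lemma k_maximal_prefix_code (T : countType) (M N : lang T) (X : seq (seq T)) :
  k_maximal (size X) M -> k_maximal (size X) N -> ~ lang_eq M N ->
  lang_eq M (gen (fun w => w \in X)) -> uniq X -> [::] \notin X ->
  prefix_code (fun w => w \in X).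
Proof.
move=> kM kN ne eM uX nX; have nilX w : w \in X -> w <> [::].
  by move=> Xw ew; case/negP: nX; rewrite -ew.
split=> // a b Xa Xb /prefixP[s eb].
case: (eqVneq a b) => // /eqP ab.
have Xpos : 0 < size X by case: (X) Xa.
have sR : (size (rem b X)).+1 = size X by rewrite size_rem // prednK.
have memR w : (w \in rem b X) = (w != b) && (w \in X) by rewrite mem_rem_uniq.
have Ra : a \in rem b X by rewrite memR Xa andbT; apply/eqP.
have incl D : (forall w, w \in rem b X -> gen (fun w => w \in D) w) ->
    gen (fun w => w \in D) s -> forall w, M w -> gen (fun w => w \in D) w.
  move=> RD Ds w /eM; apply: gen_sub => v Xv.
  case: (eqVneq v b) => [->|nvb]; first by rewrite eb; apply: gen_cat => //; apply: RD.
  by apply: RD; rewrite memR nvb.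
have Ms : M s.
  apply/(@k_maximal_gen _ _ _ (s :: rem b X) kM); rewrite /= ?sR //; last first.
    by apply: gen_in; rewrite inE eqxx.
  by apply: incl => [w Rw|]; apply: gen_in; rewrite inE ?Rw ?eqxx ?orbT.
have short w : gen (fun w => w \in X) w -> size w < size b -> gen (fun w => w \in rem b X) w.
  elim=> [|y v Xy _ IH]; first by move=> _; apply: gen_nil.
  rewrite size_cat => lt; apply: gen_cons; last by apply: IH; lia.
  by rewrite memR Xy andbT; apply/eqP => e; move: lt; rewrite e; lia.
case: (@k_maximal_not_smaller _ _ _ _ (rem b X) kM kN ne); first by rewrite -sR.
apply: incl => [w Rw|]; first exact: gen_in.
apply: short; first exact/eM.
by rewrite eb size_cat; case: (a) (nilX _ Xa) => //= *; lia.
Qed.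

Lemma gen_map_subst (T S : countType) (f : T -> seq S) (X : seq (seq T)) w :
  gen (fun v => v \in map (subst f) X) w <->
  exists2 v, gen (fun y => y \in X) v & w = subst f v.
Proof.
rewrite -gen_subst; split; apply: gen_sub => v.
  by move/mapP=> [y Xy ->]; apply: gen_in; exists y.
by case=> y Xy ->; apply: gen_in; apply: map_f.
Qed.

Lemma gen_set3 (T : countType) (x y z : seq T) :
  lang_eq (gen (set3 x y z)) (gen (fun w => w \in [:: x; y; z])).
Proof.
move=> w; split; apply: gen_sub => v; rewrite ?inE.
  by case=> [->|[->|->]]; apply: gen_in; rewrite !inE eqxx ?orbT.
by case/or3P=> /eqP->; apply: gen_in; rewrite /set3; auto.
Qed.

(** * Lifting along an injective morphism and mapping the result back *)

Theorem mainTheorem9 (Sigma : countType) (x y z u v w : seq Sigma) :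
  x <> [::] -> y <> [::] -> z <> [::] -> x <> y -> x <> z -> y <> z ->
  u <> [::] -> v <> [::] -> w <> [::] -> u <> v -> u <> w -> v <> w ->
  k_maximal 3 (gen (set3 x y z)) ->
  k_maximal 3 (gen (set3 u v w)) ->
  ~ lang_eq (gen (set3 x y z)) (gen (set3 u v w)) ->
  (exists alpha beta : seq Sigma,
     lang_eq (langI (gen (set3 x y z)) (gen (set3 u v w)))
             (gen (set2 alpha beta)))
  \/
  (exists alpha beta gamma : seq Sigma,
     alpha <> [::] /\ beta <> [::] /\ gamma <> [::] /\
     lang_eq (langI (gen (set3 x y z)) (gen (set3 u v w)))
             (gen (agb alpha gamma beta))).
Proof.
move=> nx ny nz xy xz yz nu nv nw uv uw vw kX kU ne.
have uniq3 (a b c : seq Sigma) : a <> b -> a <> c -> b <> c -> uniq [:: a; b; c].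
  by move=> /eqP ab /eqP ac /eqP bc; rewrite /= !inE negb_or ab ac bc.
have nnil3 (a b c : seq Sigma) : a <> [::] -> b <> [::] -> c <> [::] ->
    [::] \notin [:: a; b; c].
  by move=> na nb nc; rewrite !inE; apply/or3P => -[] /eqP /esym.
have ne' : ~ lang_eq (gen (set3 u v w)) (gen (set3 x y z)).
  by move=> e; apply: ne => s; split=> /e.
have pcX := @k_maximal_prefix_code _ _ _ [:: x; y; z] kX kU ne (gen_set3 x y z)
  (uniq3 _ _ _ xy xz yz) (nnil3 _ _ _ nx ny nz).
have pcU := @k_maximal_prefix_code _ _ _ [:: u; v; w] kU kX ne' (gen_set3 u v w)
  (uniq3 _ _ _ uv uw vw) (nnil3 _ _ _ nu nv nw).
(* One morphism lifts both codes at once, so that their intersection lifts as well. *)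
have [|T [f [S [injf eS hS]]]] := @reduce_to_heads _ ([:: x; y; z] ++ [:: u; v; w]).
  by move=> s; rewrite mem_cat => /orP[/pcX.1|/pcU.1].
pose X := take 3 S; pose U := drop 3 S.
have eXU : S = X ++ U by rewrite cat_take_drop.
have eX : [:: x; y; z] = map (subst f) X by rewrite map_take -eS.
have eU : [:: u; v; w] = map (subst f) U by rewrite map_drop -eS.
have sX : size X = 3 by rewrite -(size_map (subst f)) -eX.
have sU : size U = 3 by rewrite -(size_map (subst f)) -eU.
have uniqX : uniq X by rewrite -(map_inj_uniq injf) -eX uniq3.
have uniqU : uniq U by rewrite -(map_inj_uniq injf) -eU uniq3.
have lift Y : prefix_code (fun s => s \in map (subst f) Y) -> prefix_code (fun s => s \in Y).
  move=> [nY pY]; split=> [s Ys es|a b Ya Yb /prefixP[c eb]].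
    by apply: (nY (subst f s)); rewrite ?map_f // es.
  by apply/injf/pY; rewrite ?map_f // eb subst_cat prefix_prefix.
(* With at most three initials, every letter in use is one of them; their images [D] generate a
   monoid containing X* and U*, and maximality makes both equal to it. *)
have four : 4 <= size (undup (map ohead (X ++ U))).
  rewrite leqNgt ltnS; apply/negP => le3.
  pose D := map f (pmap id (undup (map ohead (X ++ U)))).
  have sD : size D <= 3 by rewrite size_map size_pmap (leq_trans (count_size _ _)).
  have SD s : s \in X ++ U -> gen (fun w => w \in D) (subst f s).
    move=> Ss; have : {subset s <= [pred t | Some t \in map ohead S]}.
      by move=> t st; apply: (hS s) => //; rewrite eXU.
    elim: s {Ss} => [_|t s IH st]; first exact: gen_nil.
    apply: gen_cons; last by apply: IH => t' st'; apply: st; rewrite inE st' orbT.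
    apply: map_f; rewrite mem_pmap map_id mem_undup -eXU.
    by apply: (st t); rewrite inE eqxx.
  apply: ne => s; rewrite (@k_maximal_gen _ _ _ D kX sD) ?(@k_maximal_gen _ _ _ D kU sD) //.
  - move=> t /gen_set3; rewrite eU; apply: gen_sub => r /mapP[r' Ur' ->].
    by apply: SD; rewrite mem_cat Ur' orbT.
  - move=> t /gen_set3; rewrite eX; apply: gen_sub => r /mapP[r' Xr' ->].
    by apply: SD; rewrite mem_cat Xr'.
(* By injectivity the two preimages of a common word coincide. *)
have image s : langI (gen (set3 x y z)) (gen (set3 u v w)) s <->
    exists2 t, langI (gen (fun w => w \in X)) (gen (fun w => w \in U)) t & s = subst f t.
  rewrite /langI !gen_set3 eX eU !gen_map_subst; split.
    by case=> -[t Xt ->] [t' Ut' /injf ett']; subst t'; exists t.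
  by case=> t [Xt Ut] ->; split; exists t.
have substn0 s : s <> [::] -> subst f s <> [::].
  by move=> ns es; apply/ns/injf.
rewrite eX in pcX; rewrite eU in pcU.
case: (four_heads_intersection uniqX uniqU sX sU (lift _ pcX) (lift _ pcU) four).
  case=> al [be eZ]; left; exists (subst f al), (subst f be) => s; rewrite image.
  split=> [[t /eZ Zt ->]|].
    have /gen_subst : exists2 r, gen (set2 al be) r & subst f t = subst f r by exists t.
    by apply: gen_sub => r [q [] -> ->]; apply: gen_in; [left|right].
  move=> gs; have /gen_subst[r /eZ Zr ->] :
      gen (fun r => exists2 q, set2 al be q & r = subst f q) s.
    apply: gen_sub gs => r [] ->; apply: gen_in.
      by exists al => //; left.
    by exists be => //; right.
  by exists r.
case=> al [be [ga [nal [nbe [nga eZ]]]]]; right.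
have subst_agb i : subst f (al ++ flatten (nseq i ga) ++ be) =
    subst f al ++ flatten (nseq i (subst f ga)) ++ subst f be.
  rewrite !subst_cat; congr (_ ++ (_ ++ _)).
  by elim: i => //= i IH; rewrite subst_cat IH.
exists (subst f al), (subst f be), (subst f ga); do 3!(split; first exact: substn0).
move=> s; rewrite image; split=> [[t /eZ Zt ->]|].
  have /gen_subst : exists2 r, gen (agb al ga be) r & subst f t = subst f r by exists t.
  apply: gen_sub => r [q [i ->] ->]; apply: gen_in; exists i; exact: subst_agb.
move=> gs; have /gen_subst[r /eZ Zr ->] :
    gen (fun r => exists2 q, agb al ga be q & r = subst f q) s.
  apply: gen_sub gs => r [i ->]; apply: gen_in.
  by exists (al ++ flatten (nseq i ga) ++ be); [exists i | rewrite subst_agb].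
by exists r.
Qed.
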